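(* For every integer $x\ge 0$, $$S_{3,0}(x)=3S_{3,0}\Big(\Big\lfloor\frac{x}{4}\Big\rfloor\Big)+\Delta_3(x)-(-1)^{s_2(\lfloor x/4\rfloor-1)}A_3(x),$$ where $A_3(x)=0$ if $x\equiv 0,1,2,3\pmod 8$ and $A_3(x)=1$ if $x\equiv 4,5,6,7\pmod 8$ (so the last term is $0$ whenever $\lfloor x/4\rfloor=0$), and $$\Delta_3(x)=\begin{cases}(-1)^{s_2(x-1)}, & x\equiv 1,7,10 \pmod{12},\\ (-1)^{s_2(x-2)}, & x\equiv 2,11\pmod{12},\\ (-1)^{s_2(x-3)}, & x\equiv 3\pmod{12},\\ 0, & \text{otherwise}.\end{cases}$$
   Context: For an integer $b\ge 2$ and integer $r\ge 0$, $s_b(r)$ denotes the sum of the digits of $r$ in base $b$. For integers $x\ge 0$, define $$S_{3,0}(x)=\sum_{0\le r<x,\; r\equiv 0 \pmod 3}(-1)^{s_{2}(r)}.$$ *)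

(* Defs.v *)
From HB Require Import structures.
From mathcomp Require Import all_boot all_order all_algebra.

Set Implicit Arguments.
Unset Strict Implicit.
Unset Printing Implicit Defensive.

Import GRing.Theory.
Local Open Scope ring_scope.

(* (r %/ b ^ i) %% b is the i-th base-b digit of r; for b >= 2 it vanishes
   when i >= r, because then b ^ i > i >= r. *)
Definition digit_sum (b r : nat) : nat := (\sum_(i < r) (r %/ b ^ i) %% b)%N.

Definition S30 (x : nat) : int :=
  \sum_(0 <= r < x | (r == 0 %[mod 3])%N) (-1) ^+ digit_sum 2 r.

Definition A3 (x : nat) : int :=
  if (x %% 8 \in [:: 0; 1; 2; 3])%N then 0 else 1.

(* In each nonzero case x is at least the number subtracted from it, so the
   truncated subtraction is the integer one. *)
Definition Delta3 (x : nat) : int :=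
  if (x %% 12 \in [:: 1; 7; 10])%N then (-1) ^+ digit_sum 2 (x - 1)
  else if (x %% 12 \in [:: 2; 11])%N then (-1) ^+ digit_sum 2 (x - 2)
  else if (x %% 12 == 3)%N then (-1) ^+ digit_sum 2 (x - 3)
  else 0.

(* Main.v *)
(** Write t n = (-1)^(s_2 n), so that t (2n) = t n and t (2n+1) = - t n.  A block
    of four consecutive integers 4n, ..., 4n+3 contributes 3 t n [3 | n] - t n to
    S_{3,0}, and t n telescopes because t n + t (n+1) = 0 for even n.  This settles
    x = 4n; Delta_3 is the contribution of the last, incomplete block. *)
Require Import Defs.
From mathcomp Require Import all_boot all_order all_algebra.
From mathcomp Require Import zify ring.

Import GRing.Theory.
Local Open Scope ring_scope.

(** Freeing the bound from [r] lets digit sums of different numbers be compared over one range. *)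
Lemma digit_sum_widen (b r k : nat) : (1 < b)%N -> (r <= k)%N ->
  digit_sum b r = (\sum_(i < k) (r %/ b ^ i) %% b)%N.
Proof.
move=> b_gt1 le_rk; rewrite /digit_sum.
rewrite -[LHS](big_mkord xpredT (fun i => ((r %/ b ^ i) %% b)%N)).
rewrite -[RHS](big_mkord xpredT (fun i => ((r %/ b ^ i) %% b)%N)).
rewrite [RHS](big_cat_nat (n := r)) //= [X in (_ = _ + X)%N]big_nat.
rewrite [X in (_ = _ + X)%N]big1 ?addn0 // => i /andP[le_ri _].
by rewrite divn_small ?mod0n // (leq_ltn_trans le_ri) // ltn_expl.
Qed.

Lemma digit_sum_cons (b n a : nat) : (a < b)%N -> (1 < b)%N ->
  digit_sum b (b * n + a) = (a + digit_sum b n)%N.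
Proof.
move=> lt_ab b_gt1; have b_gt0 : (0 < b)%N by apply: ltnW.
have le_n : (n <= b * n + a)%N by rewrite -[n in (n <= _)%N]addn0 leq_add ?leq_pmull.
rewrite (@digit_sum_widen b n _ b_gt1 le_n).
(* One extra term here: once the lowest digit [a] is split off, both sums have the same range. *)
rewrite (@digit_sum_widen b _ (b * n + a).+1) // big_ord_recl expn0 divn1.
rewrite mulnC modnMDl modn_small //; congr (_ + _)%N; apply: eq_bigr => i _.
by rewrite /bump /= expnS divnMA divnMDl // (divn_small lt_ab) addn0.
Qed.

Definition tm_sign (n : nat) : int := (-1) ^+ digit_sum 2 n.

Lemma tm_sign_double (n : nat) : tm_sign (2 * n) = tm_sign n.
Proof. by rewrite /tm_sign -[(2 * n)%N]addn0 digit_sum_cons. Qed.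

Lemma tm_sign_doubleS (n : nat) : tm_sign (2 * n + 1) = - tm_sign n.
Proof. by rewrite /tm_sign digit_sum_cons // exprS mulN1r. Qed.

Lemma tm_sign_quad (n : nat) :
  [/\ tm_sign (4 * n) = tm_sign n, tm_sign (4 * n + 1) = - tm_sign n,
      tm_sign (4 * n + 2) = - tm_sign n & tm_sign (4 * n + 3) = tm_sign n].
Proof.
split.
- by rewrite (_ : 4 * n = 2 * (2 * n))%N ?tm_sign_double //; lia.
- by rewrite (_ : 4 * n = 2 * (2 * n))%N ?tm_sign_doubleS ?tm_sign_double //; lia.
- rewrite (_ : 4 * n + 2 = 2 * (2 * n + 1))%N; last by lia.
  by rewrite tm_sign_double tm_sign_doubleS.
- rewrite (_ : 4 * n + 3 = 2 * (2 * n + 1) + 1)%N; last by lia.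
  by rewrite !tm_sign_doubleS opprK.
Qed.

Lemma S30S (x : nat) :
  S30 x.+1 = S30 x + (if (x %% 3 == 0)%N then tm_sign x else 0).
Proof. by rewrite /S30 [in LHS]big_mkcond big_nat_recr //= -big_mkcond. Qed.

Lemma A3_quad (n j : nat) : (j < 4)%N -> A3 (4 * n + j) = (odd n)%:R.
Proof.
move=> lt_j4; rewrite /A3 (_ : (4 * n + j) %% 8 = 4 * odd n + j)%N; last by lia.
by case: (odd n); case: j lt_j4 => [|[|[|[|]]]].
Qed.

(** Since 4 is 1 modulo 3, the residue of [n] modulo 3 alone decides which members of the block
    count. *)
Lemma S30_quadS (n i : nat) :
  S30 (4 * n + i.+1) = S30 (4 * n + i)
    + (if ((n %% 3 + i) %% 3 == 0)%N then tm_sign (4 * n + i) else 0).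
Proof.
by rewrite addnS S30S (_ : (4 * n + i) %% 3 = (n %% 3 + i) %% 3)%N //; lia.
Qed.

(** Exactly one of 4n, 4n+1, 4n+2 is a multiple of 3; [Delta3] is its sign once [j] has passed it,
    and 0 before. *)
Lemma S30_partial_block (n j : nat) : (j < 4)%N ->
  S30 (4 * n + j) = S30 (4 * n) + Delta3 (4 * n + j).
Proof.
move=> lt_j4; rewrite /Delta3 -!/(tm_sign _).
have -> : ((4 * n + j) %% 12 = 4 * (n %% 3) + j)%N by lia.
have : (n %% 3 < 3)%N by rewrite ltn_mod.
by case: j lt_j4 => [|[|[|[|//]]]] _; rewrite ?S30_quadS;
  case: (n %% 3)%N => [|[|[|//]]] _ /=; rewrite -?addnBA // ?addn0 ?addr0.
Qed.

(** The signs in the block are +, -, -, + times [tm_sign n]. If 3 divides [n], both outer members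
    count; otherwise a single inner one does. *)
Lemma S30_block (n : nat) :
  S30 (4 * n.+1) = S30 (4 * n) - tm_sign n
                   + (if (n %% 3 == 0)%N then 3 * tm_sign n else 0).
Proof.
have [t0 t1 t2 t3] := tm_sign_quad n.
rewrite mulnS addnC !S30_quadS !addn0 t0 t1 t2 t3.
have : (n %% 3 < 3)%N by rewrite ltn_mod.
by case: (n %% 3)%N => [|[|[|//]]] _ /=; ring.
Qed.

Lemma S30_quad (n : nat) :
  S30 (4 * n) = 3 * S30 n - tm_sign (n - 1) * (odd n)%:R.
Proof.
(* At 0 the truncated [0 - 1] is harmless, as the parity factor vanishes. *)
elim: n => [|n IHn]; first by rewrite /S30 big_geq // !mulr0 subr0.
rewrite S30_block IHn S30S subSS subn0 /=.
(* For odd [n] the new term cancels the old correction; for even [n] it becomes the correction at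
   [n.+1]. *)
have -> : tm_sign n = (if odd n then - tm_sign (n - 1) else tm_sign n).
  case: ifP => // odd_n.
  rewrite {1}(_ : n = 2 * n./2 + 1)%N; last by lia.
  rewrite (_ : n - 1 = 2 * n./2)%N; last by lia.
  by rewrite tm_sign_doubleS tm_sign_double.
by case: (odd n) => /=; case: ifP => _; ring.
Qed.

Theorem theorem3 (x : nat) :
  S30 x = 3 * S30 (x %/ 4)%N + Delta3 x
          - (-1) ^+ digit_sum 2 (x %/ 4 - 1)%N * A3 x.
Proof.
have lt_j4 : (x %% 4 < 4)%N by rewrite ltn_mod.
have x_eq : (x = 4 * (x %/ 4) + x %% 4)%N by rewrite mulnC -divn_eq.
have A3x : A3 x = (odd (x %/ 4))%:R by rewrite {1}x_eq A3_quad.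
rewrite -/(tm_sign _) A3x {1}x_eq S30_partial_block // -x_eq S30_quad.
exact: addrAC.
Qed.
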